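(* For every $\omega=(\omega_0,\dots,\omega_d)\in\mathbb{R}^{d+1}_{>0}$, let $S(\omega)=\operatorname{conv}\{-\omega_0\mathbf{1}_d,\omega_1e_1,\dots,\omega_de_d\}\subseteq\mathbb{R}^d$. Then \[\mu(S(\omega),\mathbb{Z}^d)=\frac{\sum_{0\le i<j\le d}\frac{1}{\omega_i\omega_j}}{\sum_{i=0}^d\frac{1}{\omega_i}}=\frac12\,\frac{\sum_{i=0}^d \operatorname{Vol}_{\pi_i(\mathbb{Z}^d)}(\pi_i(S(\omega)))}{\operatorname{Vol}_{\mathbb{Z}^d}(S(\omega))},\] where $\pi_i:\mathbb{R}^d\to\mathbb{R}^{d-1}$ is the linear projection whose kernel is spanned by the $i$-th vertex of $S(\omega)$ (the vertices being $-\omega_0\mathbf{1}_d,\omega_1e_1,\dots,\omega_de_d$ in this order).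
   Context: $\mathbf{1}_d=(1,\dots,1)\in\mathbb{R}^d$, $e_i$ the standard unit vectors. For a convex body $K$ and lattice $\Lambda$, $\mu(K,\Lambda)=\min\{\mu\ge0:\mu K+\Lambda=\mathbb{R}^d\}$. For a $k$-dimensional convex body $K$ in a $k$-dimensional space with lattice $\Lambda$, the normalized volume is $\operatorname{Vol}_\Lambda(K)=k!\,\operatorname{vol}(K)/\det(\Lambda)$, so that unimodular simplices have normalized volume $1$. *)

(* Defs.v *)
From HB Require Import structures.
From mathcomp Require Import all_boot all_order all_algebra.
From mathcomp Require Import all_classical all_reals all_analysis.

Set Implicit Arguments.
Unset Strict Implicit.
Unset Printing Implicit Defensive.

Import Order.TTheory GRing.Theory Num.Theory.

Local Open Scope classical_set_scope.
Local Open Scope ring_scope.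

(** Points of R^n are row vectors. *)

Definition conv_hull (R : realType) (n k : nat) (v : 'I_k -> 'rV[R]_n) :
    set 'rV[R]_n :=
  [set x | exists2 a : 'I_k -> R, (forall i, 0 <= a i) /\ \sum_i a i = 1
                                & x = \sum_i a i *: v i].

Definition Zlattice (R : realType) (n : nat) : set 'rV[R]_n :=
  [set x | forall j, x ord0 j \is a Num.int].
Arguments Zlattice : clear implicits.

(** The rows of [B] form a basis of the full-rank lattice [L]. *)
Definition is_lattice_basis (R : realType) (n : nat) (L : set 'rV[R]_n)
    (B : 'M[R]_n) : Prop :=
  B \in unitmx /\ L = [set z *m B | z in Zlattice R n].

(** All bases of a full-rank lattice have the same [`|\det B|]; the value is 0
    when [L] is not a full-rank lattice. *)
Definition lattice_det (R : realType) (n : nat) (L : set 'rV[R]_n) : R :=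
  xget 0 [set `|\det B| | B in is_lattice_basis L].

Definition covering_dilations (R : realType) (n : nat)
    (K L : set 'rV[R]_n) : set R :=
  [set m | 0 <= m /\ [set m *: x + z | x in K & z in L] = setT].

(** [m] is the covering radius mu(K, L): the minimum is attained at [m]. *)
Definition is_covering_radius (R : realType) (n : nat) (K L : set 'rV[R]_n)
    (m : R) : Prop :=
  covering_dilations K L m /\ lbound (covering_dilations K L) m.

(** Lebesgue measure on R^n, on Borel sets, is the n-fold product of
    [lebesgue_measure] on the nested product R * (R * (.. * unit)); for n = 0
    it is the unit mass on a point. *)
Fixpoint Rn_display (n : nat) : measure_display :=
  if n is m.+1 then measure_prod_display (default_measure_display, Rn_display m)
  else default_measure_display.

Fixpoint Rn_space (R : realType) (n : nat) : measurableType (Rn_display n) :=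
  match n with
  | 0 => unit
  | m.+1 => (measurableTypeR R * Rn_space R m)%type
  end.

Fixpoint Rn_measure (R : realType) (n : nat) : set (Rn_space R n) -> \bar R :=
  match n return set (Rn_space R n) -> \bar R with
  | 0 => \d_tt
  | m.+1 => (@lebesgue_measure R \x @Rn_measure R m)%E
  end.

Fixpoint Rn_coords (R : realType) (n : nat) : 'rV[R]_n -> Rn_space R n :=
  match n with
  | 0 => fun=> tt
  | m.+1 => fun x => (x ord0 ord0, Rn_coords (col' ord0 x))
  end.

Definition volume (R : realType) (n : nat) (A : set 'rV[R]_n) : \bar R :=
  @Rn_measure R n (@Rn_coords R n @` A).

Definition normalized_volume (R : realType) (n : nat) (L K : set 'rV[R]_n) : R :=
  n`!%:R * fine (volume K) / lattice_det L.

(** [lift ord0 j] has value [j.+1], so for i > 0 vertex i is [w i] times the i-th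
    standard unit vector. *)
Definition S_vertex (R : realType) (d : nat) (w : 'I_d.+1 -> R) (i : 'I_d.+1) :
    'rV[R]_d :=
  if unlift ord0 i is Some j then w i *: delta_mx ord0 j
  else - w i *: const_mx 1.

Definition S_simplex (R : realType) (d : nat) (w : 'I_d.+1 -> R) : set 'rV[R]_d :=
  conv_hull (S_vertex w).

(* Main.v *)
Require Import Defs.
From HB Require Import structures.
From mathcomp Require Import all_boot all_order all_algebra.
From mathcomp Require Import all_classical all_reals all_analysis.
From mathcomp Require Import measurable_realfun ring lra.

Set Implicit Arguments.
Unset Strict Implicit.
Unset Printing Implicit Defensive.

Import Order.TTheory GRing.Theory Num.Theory.
Import numFieldNormedType.Exports.

Local Open Scope classical_set_scope.
Local Open Scope ring_scope.

(** Write R^d as R^(d+1) / R(1,..,1): a point of [S_simplex w] is then represented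
    by [b >= 0] with [\sum_i b i / w i = 1], and all the vertices play the same
    role.  Covering radius: translating [y] by integer parts relative to its [i]-th
    coordinate bounds the dilation needed by [\sum_j frac (y j - y i) / w j]; since
    [frac t + frac (- t) <= 1], the mean over [i] with weights [1 / w i] is at most
    the claimed value.  The bound is attained at the point whose coordinates are
    the normalized partial sums of the [1 / w j].  Volumes: the projection along
    the [i]-th vertex sends the lattice and the simplex to the linear image, under
    one and the same matrix, of the standard lattice and of the simplex with the
    weight [w i] dropped, so the determinants of that matrix cancel and
    [Vol (S_simplex w) = (\prod_i w i) * \sum_i (w i)^-1] settles all cases. *)

(** * Linear change of variables for the volume *)

Section AffineLine.
Variable R : realType.
Local Notation leb := (@lebesgue_measure R).

Lemma measurable_affine_fun (a b : R) :
  measurable_fun setT (fun x : measurableTypeR R => (a * x + b) : measurableTypeR R).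
Proof.
apply: measurable_funD; last exact: measurable_cst.
by apply: measurable_funM; [exact: measurable_cst|exact: measurable_id].
Qed.

(** By uniqueness of Lebesgue measure: [a] times the pushforward along the affine map has the right
    value on half-open intervals. *)
Lemma lebesgue_measure_affine_gt0 (a b : R) (A : set (measurableTypeR R)) :
  0 < a -> measurable A ->
  (a%:E * leb [set x : R | A ((a * x + b)%R)] = leb A)%E.
Proof.
move=> a0 mA.
pose f : measurableTypeR R -> measurableTypeR R := fun x => a * x + b.
have mf : measurable_fun setT f := measurable_affine_fun a b.
have a0' : 0 <= a by exact: ltW.
pose nu : {measure set (measurableTypeR R) -> \bar R} :=
  mscale (NngNum a0') (pushforward leb f).
apply/esym/(@lebesgue_measure_unique _ (nu mf)) => //= _ [[x y]] _ <-.
rewrite /nu /mscale /pushforward /=.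
rewrite [X in (_ * leb X)%E](_ : _ = [set` `](x - b) / a, (y - b) / a]]); last first.
  apply/seteqP; split=> t /=; rewrite !in_itv /= ltr_pdivrMr// ler_pdivlMr//;
  by rewrite /f ltrBlDr lerBrDr (mulrC t).
rewrite !lebesgue_measure_itv/= !lte_fin ltr_pM2r ?invr_gt0// ltrD2r.
case: ifP => _; last by rewrite mule0.
rewrite -!EFinD -EFinM; congr (_%:E).
by rewrite -mulrBl mulrCA divff ?gt_eqF// mulr1; ring.
Qed.

Lemma lebesgue_measure_affine (a b : R) (A : set (measurableTypeR R)) :
  a != 0 -> measurable A ->
  (`|a|%:E * leb [set x : R | A ((a * x + b)%R)] = leb A)%E.
Proof.
move=> a_neq0 mA.
have [a0|a0] := ltP 0 a; first by rewrite gtr0_norm// lebesgue_measure_affine_gt0.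
have Na0 : 0 < - a by rewrite oppr_gt0 lt_neqAle a_neq0.
rewrite ler0_norm// -(lebesgue_measure_affine_gt0 b Na0 mA); congr (_ * _)%E.
rewrite -lebesgue_measureN.
  by congr (leb _); apply/funext => x; rewrite /preimage /= mulrN mulNr.
rewrite -[X in measurable X]setTI.
exact: (measurable_affine_fun a b).
Qed.

End AffineLine.

(** * Row vectors as points of the product space, and slicing of volumes *)

Section RnCoordinates.
Variable R : realType.

Fixpoint of_Rn n : Rn_space R n -> 'rV[R]_n :=
  match n return Rn_space R n -> 'rV[R]_n with
  | 0 => fun=> 0
  | m.+1 => fun t => row_mx (t.1)%:M (of_Rn t.2)
  end.

Lemma row_mx00 m (a : R) (y : 'rV[R]_m) :
  (row_mx a%:M y : 'rV_m.+1) ord0 ord0 = a.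
Proof.
have -> : ord0 = lshift m (ord0 : 'I_1) by exact: val_inj.
by apply: etrans (row_mxEl _ _ _ _) _; rewrite mxE eqxx.
Qed.

Lemma row_mx0lift m (a : R) (y : 'rV[R]_m) (j : 'I_m) :
  (row_mx a%:M y : 'rV_m.+1) ord0 (lift ord0 j) = y ord0 j.
Proof.
have -> : lift ord0 j = rshift 1 j by exact: val_inj.
exact: row_mxEr.
Qed.

Lemma col'_row_mx m (a : R) (y : 'rV[R]_m) :
  col' ord0 (row_mx a%:M y : 'rV_m.+1) = y.
Proof. by apply/rowP => j; rewrite mxE row_mx0lift. Qed.

Lemma row_mx_col' m (x : 'rV[R]_m.+1) : row_mx (x ord0 ord0)%:M (col' ord0 x) = x.
Proof.
apply/rowP => j; case: (unliftP ord0 j) => [k|] ->.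
  by rewrite row_mx0lift mxE.
exact: row_mx00.
Qed.

Lemma Rn_coordsK n : cancel (@Rn_coords R n) (@of_Rn n).
Proof.
elim: n => [|n IH] x /=; first by apply/rowP => -[].
by rewrite IH row_mx_col'.
Qed.

Lemma of_RnK n : cancel (@of_Rn n) (@Rn_coords R n).
Proof.
elim: n => [|n IH] /=; first by case.
by case=> a t /=; rewrite row_mx00 col'_row_mx IH.
Qed.

Lemma image_Rn_coords n (A : set 'rV[R]_n) :
  @Rn_coords R n @` A = @of_Rn n @^-1` A.
Proof.
apply/seteqP; split => [_ [x Ax <-]|t At]; rewrite /preimage /= ?Rn_coordsK//.
by exists (of_Rn t) => //; rewrite of_RnK.
Qed.

Lemma product_measure1_sigma_finite d1 d2 (T1 : measurableType d1)
    (T2 : measurableType d2) (m1 : {sigma_finite_measure set T1 -> \bar R})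
    (m2 : {sigma_finite_measure set T2 -> \bar R}) :
  sigma_finite setT (m1 \x m2)%E.
Proof.
have [F FT Ffin] := sigma_finiteT m1; have [G GT Gfin] := sigma_finiteT m2.
exists (fun k => if unpickle k is Some (i, j) then F i `*` G j else set0).
  apply/esym/seteqP; split => // -[x y] _.
  have /= [i _ Fx] : (\bigcup_i F i) x by rewrite -FT.
  have /= [j _ Gy] : (\bigcup_j G j) y by rewrite -GT.
  by exists (pickle (i, j)) => //; rewrite pickleK.
move=> k; case: unpickle => [[i j]|]; last by split => //; rewrite measure0.
have [mF F_fin] := Ffin i; have [mG G_fin] := Gfin j.
split; first exact: measurableX.
by rewrite product_measure1E// lte_mul_pinfty// ge0_fin_numE.
Qed.

(* The canonical sigma-finite structure on [m1 \x m2] in the library is the one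
   of products of subprobabilities, so it cannot be inferred here. *)
Definition sigma_finite_product d1 d2 (T1 : measurableType d1)
    (T2 : measurableType d2) (m1 : {sigma_finite_measure set T1 -> \bar R})
    (m2 : {sigma_finite_measure set T2 -> \bar R}) :
    {sigma_finite_measure set (T1 * T2)%type -> \bar R} :=
  HB.pack (m1 \x m2)%E (Measure.on (m1 \x m2)%E)
    (Measure_isSigmaFinite.Build _ _ _ (m1 \x m2)%E
      (product_measure1_sigma_finite m1 m2)).

(** The product measure is repacked over [Rn_space R n.+1], which is only convertible to the product
    type, so that later inference works with this type. *)
Definition Rn_measure_succ n
    (mu : {sigma_finite_measure set (Rn_space R n) -> \bar R}) :
    {measure set (Rn_space R n.+1) -> \bar R} :=
  let nu := sigma_finite_product (@lebesgue_measure R) mu in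
  HB.pack (nu : set (Rn_space R n.+1) -> \bar R)
    (isMeasure.Build _ (Rn_space R n.+1) _ nu (measure0 nu) (measure_ge0 nu)
      (@measure_semi_sigma_additive _ _ _ nu)).

Definition Rn_sigma_finite_succ n
    (mu : {sigma_finite_measure set (Rn_space R n) -> \bar R}) :
    {sigma_finite_measure set (Rn_space R n.+1) -> \bar R} :=
  HB.pack (Rn_measure_succ mu : set (Rn_space R n.+1) -> \bar R)
    (Measure.on (Rn_measure_succ mu))
    (Measure_isSigmaFinite.Build _ (Rn_space R n.+1) _ (Rn_measure_succ mu)
      (product_measure1_sigma_finite (@lebesgue_measure R) mu)).

Fixpoint Rn_sigma_finite n :
    {sigma_finite_measure set (Rn_space R n) -> \bar R} :=
  match n return {sigma_finite_measure set (Rn_space R n) -> \bar R} with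
  | 0 => \d_tt
  | m.+1 => Rn_sigma_finite_succ (Rn_sigma_finite m)
  end.

Lemma Rn_sigma_finiteE n : Rn_sigma_finite n = @Rn_measure R n :> (set _ -> \bar R).
Proof.
by elim: n => [|n IH] //=; rewrite -IH.
Qed.

Lemma volumeE n (A : set 'rV[R]_n) :
  volume A = Rn_sigma_finite n (@of_Rn n @^-1` A).
Proof. by rewrite /volume image_Rn_coords Rn_sigma_finiteE. Qed.

Definition measurable_rV n (A : set 'rV[R]_n) := measurable (@of_Rn n @^-1` A).

Lemma measurable_of_Rn n (j : 'I_n) :
  measurable_fun setT (fun t : Rn_space R n => of_Rn t ord0 j).
Proof.
elim: n j => [[]//|n IH] j; case: (unliftP ord0 j) => [k|] ->.
  rewrite (_ : (fun _ => _) = (fun t => of_Rn t ord0 k) \o snd); last first.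
    by apply/funext => t /=; rewrite row_mx0lift.
  exact: measurableT_comp.
rewrite (_ : (fun _ => _) = fst); first exact: measurable_fst.
by apply/funext => t /=; rewrite row_mx00.
Qed.

Lemma measurable_Rn_coords d (T : measurableType d) n (f : T -> 'rV[R]_n) :
  (forall j, measurable_fun setT (fun t => f t ord0 j)) ->
  measurable_fun setT (fun t => Rn_coords (f t)).
Proof.
elim: n f => [|n IH] f mf /=; first exact: measurable_cst.
apply/measurable_fun_pairP; split; first exact: mf.
by apply: IH => j; under eq_fun do rewrite mxE; exact: mf.
Qed.

Lemma measurable_rV_preimage n m (f : 'rV[R]_n -> 'rV[R]_m) (A : set 'rV[R]_m) :
  (forall j, measurable_fun setT (fun t => f (of_Rn t) ord0 j)) ->
  measurable_rV A -> measurable_rV (f @^-1` A).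
Proof.
move=> mf mA; rewrite /measurable_rV.
have := measurable_Rn_coords mf measurableT mA.
rewrite setTI; congr measurable; apply/funext => t.
by rewrite /preimage /= Rn_coordsK.
Qed.

Lemma measurable_rV_affine n m (M : 'M[R]_(n, m)) (c : 'rV[R]_m) (A : set 'rV[R]_m) :
  measurable_rV A -> measurable_rV [set x | A (x *m M + c)].
Proof.
apply: measurable_rV_preimage => j.
under eq_fun do rewrite !mxE.
apply: measurable_funD; last exact: measurable_cst.
apply: measurable_sum => i.
by apply: measurable_funM; [exact: measurable_of_Rn|exact: measurable_cst].
Qed.

(** This is the definition of the product measure, so it holds for every set [A]. *)
Lemma volume_fst n (A : set 'rV[R]_n.+1) :
  volume A = (\int[@lebesgue_measure R]_x
               volume [set y : 'rV[R]_n | A (row_mx x%:M y)])%E.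
Proof.
rewrite volumeE /= /product_measure1; apply: eq_integral => x _ /=.
rewrite volumeE; congr (Rn_sigma_finite n _); apply/funext => t.
by rewrite xsectionE /preimage.
Qed.

(** Slicing in the other order rests on uniqueness of the product measure, hence the measurability
    hypothesis. *)
Lemma volume_snd n (A : set 'rV[R]_n.+1) : measurable_rV A ->
  volume A = (\int[Rn_sigma_finite n]_t
    @lebesgue_measure R [set x : R | A (row_mx x%:M (of_Rn t))])%E.
Proof.
move=> mA; rewrite volumeE /=.
rewrite (@product_measure_unique _ _ _ _ _ _ _
  (product_measure2 lebesgue_measure (Rn_sigma_finite n)))//=.
  apply: eq_integral => t _ /=; congr lebesgue_measure; apply/funext => x.
  by rewrite ysectionE /preimage.
by move=> B C mB mC; rewrite product_measure2E.
Qed.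

End RnCoordinates.

(** * Affine maps that preserve a family of slices *)

Section LinearVolume.
Variable R : realType.

(** Stated with preimages, which stay measurable and compose without inverting [M]. *)
Definition scales_volume n (M : 'M[R]_n) (c : 'rV[R]_n) :=
  forall A : set 'rV[R]_n, measurable_rV A ->
  (`|\det M|%:E * volume [set x : 'rV[R]_n | A (x *m M + c)%R] = volume A)%E.

Lemma scales_volume_comp n (M1 M2 : 'M[R]_n) (c1 c2 : 'rV[R]_n) :
  scales_volume M1 c1 -> scales_volume M2 c2 ->
  scales_volume (M1 *m M2) (c1 *m M2 + c2).
Proof.
move=> h1 h2 A mA; rewrite det_mulmx normrM mulrC EFinM -muleA.
rewrite -(h2 _ mA) -(h1 _ (measurable_rV_affine M2 c2 mA)).
congr (_ * (_ * volume _))%E; apply/funext => x /=.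
by rewrite mulmxDl mulmxA addrA.
Qed.

(** The map sends [(x, y)] to [(a x + y u + b, y)]: on each line with [y] fixed it is affine with
    slope [a], so the one-dimensional case is integrated over [y]. *)
Lemma scales_volume_lower n (a b : R) (u : 'cV[R]_n) : a != 0 ->
  scales_volume (block_mx a%:M 0 u 1%:M : 'M[R]_n.+1) (row_mx b%:M 0).
Proof.
move=> a0 A mA.
have mA' := @measurable_rV_affine R n.+1 n.+1
  (block_mx a%:M 0 u 1%:M : 'M[R]_n.+1) (row_mx b%:M 0) _ mA.
rewrite (volume_snd mA) (volume_snd mA').
have -> : \det (block_mx a%:M 0 u 1%:M : 'M[R]_n.+1) = a.
  by rewrite (det_lblock (a%:M : 'M[R]_1) u (1%:M : 'M[R]_n)) det_scalar1 det1 mulr1.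
rewrite -ge0_integralZl//; last first.
  have := lebesgue_integral_fubini.measurable_fun_ysection (@lebesgue_measure R) mA'.
  congr measurable_fun; apply/funext => t /=; congr lebesgue_measure.
  by apply/funext => x; rewrite ysectionE /preimage.
apply: eq_integral => t _.
pose s := (of_Rn t *m u) ord0 ord0.
have mAt : measurable [set x : measurableTypeR R | A (row_mx x%:M (of_Rn t))].
  have := measurable_ysection t mA.
  by congr measurable; apply/funext => x; rewrite ysectionE /preimage.
rewrite -(lebesgue_measure_affine (s + b) a0 mAt).
congr (_ * lebesgue_measure _)%E; apply/funext => x /=; congr A.
rewrite (mul_row_block (x%:M : 'M[R]_1) (of_Rn t) (a%:M : 'M[R]_1) 0 u 1%:M).
rewrite mulmx0 mulmx1 add0r (add_row_mx (m := 1) (n1 := 1)) addr0.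
suff -> : x%:M *m a%:M + of_Rn t *m u + b%:M = (a * x + (s + b))%:M :> 'M[R]_1 by [].
apply/matrixP => i j.
by rewrite !ord1 -scalar_mxM /s !mxE eqxx !mulr1n addrA (mulrC x a).
Qed.

(** The map sends [(x, y)] to [(x, y N + x v + c)]. The translation on the slice at [x] depends on
    [x], so the hypothesis on [N] ranges over all translations. *)
Lemma scales_volume_upper n (v c : 'rV[R]_n) (N : 'M[R]_n) :
  (forall c', scales_volume N c') ->
  scales_volume (block_mx 1%:M v 0 N : 'M[R]_n.+1) (row_mx (0 : 'M[R]_1) c).
Proof.
move=> hN A mA.
have mA' := @measurable_rV_affine R n.+1 n.+1
  (block_mx 1%:M v 0 N : 'M[R]_n.+1) (row_mx (0 : 'M[R]_1) c) _ mA.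
rewrite !volume_fst.
have -> : \det (block_mx 1%:M v 0 N : 'M[R]_n.+1) = \det N.
  by rewrite (det_ublock (1%:M : 'M[R]_1) v N) det1 mul1r.
rewrite -ge0_integralZl//; last first.
- by move=> *; rewrite volumeE.
  have := measurable_fun_xsection (Rn_sigma_finite R n) mA'.
  congr measurable_fun; apply/funext => x /=; rewrite volumeE.
  congr (Rn_sigma_finite R n _).
  by apply/funext => t; rewrite xsectionE /preimage.
apply: eq_integral => x _.
have mAx : measurable_rV [set y : 'rV[R]_n | A (row_mx x%:M y)].
  have := measurable_xsection x mA.
  by congr measurable; apply/funext => t; rewrite xsectionE /preimage.
rewrite -(hN (x *: v + c) _ mAx).
congr (_ * volume _)%E; apply/funext => y /=; congr A.
rewrite (mul_row_block (x%:M : 'M[R]_1) y (1%:M : 'M[R]_1) v 0 N).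
rewrite mulmx0 mulmx1 addr0 (add_row_mx (m := 1) (n1 := 1)) addr0.
by rewrite mul_scalar_mx addrA (addrC (y *m N)).
Qed.

End LinearVolume.

Section LinearVolumeGeneral.
Variable R : realType.

(* Right multiplication by [block_mx 1 w 0 1] turns the lower right block [N0]
   into [N0 + u0 *m w].  Its determinant is, up to a nonzero factor,
   [w *m k1 - k0], where [col_mx k0 k1] is the first column of [invmx M]. *)
Lemma unitmx_complete_block n (M : 'M[R]_(1 + n)) : M \in unitmx ->
  exists w : 'rV[R]_n, drsubmx M + dlsubmx M *m w \in unitmx.
Proof.
move=> uM; set u0 := dlsubmx M; set N0 := drsubmx M.
pose k0 := ulsubmx (invmx M); pose k1 := dlsubmx (invmx M).
pose g := ursubmx (invmx M); pose H := drsubmx (invmx M).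
have := mulmxV uM; rewrite -[M in M *m _]submxK -[invmx M]submxK mulmx_block.
rewrite -/u0 -/N0 -/k0 -/k1 -/g -/H scalar_mx_block => /eq_block_mx[_ _ uk ug].
suff [w sw] : exists w : 'rV[R]_n, (w *m k1 - k0) ord0 ord0 != 0.
  exists w; set s := (w *m k1 - k0) ord0 ord0 in sw.
  have sE : w *m k1 - k0 = s%:M by rewrite [LHS]mx11_scalar.
  have N'k : (N0 + u0 *m w) *m k1 = s *: u0.
    rewrite -mul_mx_scalar -sE mulmxDl mulmxBr mulmxA.
    by move/eqP: uk; rewrite addrC addr_eq0 => /eqP ->; rewrite addrC.
  have N'H : (N0 + u0 *m w) *m H = 1%:M + u0 *m (w *m H - g).
    by rewrite -ug mulmxDl mulmxBr mulmxA [RHS]addrC addrA subrK addrC.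
  (* By [N'k] and [N'H], the correction of [H] by a multiple of [k1] is a right inverse. *)
  have [] // := @mulmx1_unit _ _ (N0 + u0 *m w) (H - s^-1 *: (k1 *m (w *m H - g))).
  rewrite mulmxBr N'H -scalemxAr mulmxA N'k -scalemxAl scalerA mulVf// scale1r.
  by rewrite addrK.
have [k00|k00] := eqVneq (k0 ord0 ord0) 0; last first.
  by exists 0; rewrite mul0mx sub0r mxE oppr_eq0.
(* With [k0 = 0] this choice makes the scalar a sum of squares; if it vanished, the first column of
   [invmx M] would be zero. *)
exists k1^T; rewrite mxE [X in _ + X]mxE k00 subr0 mxE.
apply/negP => /eqP k1k1.
have k10 : k1 = 0.
  apply/colP => i; rewrite [RHS]mxE.
  have /psumr_eq0P : forall i : 'I_n, true -> 0 <= k1^T ord0 i * k1 i ord0.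
    by move=> j _; rewrite mxE -expr2 sqr_ge0.
  move=> /(_ k1k1 i isT)/eqP; rewrite mxE -expr2 sqrf_eq0 => /eqP.
  by [].
have k0E : k0 = 0 by rewrite [k0]mx11_scalar k00 -scalemx1 scale0r.
have : invmx M *m col_mx 1%:M 0 = 0.
  rewrite -[invmx M]submxK -/k0 -/k1 k0E k10 mul_block_col.
  by rewrite !mul0mx !mulmx0 !addr0 col_mx0.
move/(congr1 (mulmx M)); rewrite mulmxA mulmxV// mul1mx mulmx0.
move/(congr1 (@usubmx R 1 n 1)); rewrite col_mxKu => /matrixP/(_ ord0 ord0)/eqP.
by rewrite !mxE eqxx oner_eq0.
Qed.

(** Block elimination: once a shear has made the lower right block [N] invertible, [a] is its Schur
    complement. Every factor has one of the two slice-preserving shapes treated above. *)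
Lemma unitmx_block_factorization n (M : 'M[R]_(1 + n)) : M \in unitmx ->
  exists (v w : 'rV[R]_n) (N : 'M[R]_n) (a : R) (u : 'cV[R]_n),
    [/\ N \in unitmx, a != 0 & M =
      block_mx 1%:M v 0 N *m block_mx a%:M 0 u 1%:M *m block_mx 1%:M w 0 1%:M].
Proof.
move=> uM; have [w uN] := unitmx_complete_block uM.
set N := drsubmx M + dlsubmx M *m w in uN.
pose v := ulsubmx M *m w + ursubmx M; pose u := invmx N *m dlsubmx M.
pose a := (ulsubmx M - v *m u) ord0 ord0.
have aE : a%:M = ulsubmx M - v *m u by rewrite [RHS]mx11_scalar.
have ME : M = block_mx 1%:M v 0 N *m block_mx a%:M 0 u 1%:M *m
              block_mx 1%:M (- w) 0 1%:M.
  rewrite !mulmx_block !mul1mx !mulmx1 !mulmx0 !mul0mx !addr0 !add0r aE subrK.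
  rewrite mulmxA mulmxV// mul1mx !mulmxN /v /N addKr.
  by rewrite addrC addrK submxK.
exists v, (- w), N, a, u; split => //; apply/eqP => a0; move: uM.
rewrite unitmxE ME !det_mulmx det_ublock det_lblock a0 !det_scalar1.
by rewrite mul0r mulr0 mul0r unitr0.
Qed.

Lemma scales_volume0 (M : 'M[R]_0) (c : 'rV[R]_0) : scales_volume M c.
Proof.
move=> A _; rewrite det_mx00 normr1 mul1e; congr volume.
by apply/funext => x /=; congr A; rewrite [LHS]thinmx0 [RHS]thinmx0.
Qed.

Lemma scales_volume_shift n (c : 'rV[R]_n) : scales_volume 1%:M c.
Proof.
elim: n c => [|n IH] c; first exact: scales_volume0.
have h1 := @scales_volume_lower R n 1 (c ord0 ord0) 0 (oner_neq0 _).
have h2 := @scales_volume_upper R n 0 (col' ord0 c) 1%:M IH.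
have := scales_volume_comp h1 h2.
rewrite -(@scalar_mx_block R 1 n) !mulmx1.
rewrite (add_row_mx (m := 1) (n1 := 1)) addr0 add0r.
by rewrite row_mx_col'.
Qed.

(** Induction on the dimension: the block [N] of the factorization is smaller, and the translation
    by [c] is composed last. *)
Theorem volume_affine n (M : 'M[R]_n) (c : 'rV[R]_n) (A : set 'rV[R]_n) :
  M \in unitmx -> measurable_rV A ->
  (`|\det M|%:E * volume [set x : 'rV[R]_n | A (x *m M + c)%R] = volume A)%E.
Proof.
move=> uM; move: A; elim: n M c uM => [|n IH] M c uM; first exact: scales_volume0.
have [v [w [N [a [u [uN a0 ->]]]]]] := unitmx_block_factorization uM.
have h1 := scales_volume_upper v 0 (fun c' => IH N c' uN).
have h2 := scales_volume_lower 0 u a0.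
have h3 := scales_volume_upper w 0 (@scales_volume_shift n).
have := scales_volume_comp (scales_volume_comp (scales_volume_comp h1 h2) h3)
  (scales_volume_shift c).
rewrite mulmx1 row_mx0 mul0mx add0r.
have -> : row_mx 0%:M 0 = 0 :> 'rV[R]_(1 + n) by rewrite -scalemx1 scale0r row_mx0.
by rewrite mul0mx add0r mul0mx add0r.
Qed.

End LinearVolumeGeneral.

(** * The corner simplex *)

Section CornerSimplex.
Variable R : realType.

(** The standard simplex with a vertex at the origin, dilated by [r]; it is empty for negative
    [r]. *)
Definition corner n (r : R) : set 'rV[R]_n :=
  [set x | (forall j, 0 <= x ord0 j) /\ \sum_j x ord0 j <= r].

Lemma measurable_corner n r : measurable_rV (@corner n r).
Proof.
rewrite /measurable_rV /corner /preimage /=.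
have -> : [set t : Rn_space R n |
    (forall j, 0 <= of_Rn t ord0 j) /\ \sum_j of_Rn t ord0 j <= r] =
  (\bigcap_(j in [set: 'I_n]) ((fun t => of_Rn t ord0 j) @^-1` `[0, +oo[)) `&`
  ((fun t => \sum_j of_Rn t ord0 j) @^-1` `]-oo, r]).
  apply/seteqP; split => t /=; rewrite /preimage /= in_itv /=.
    by move=> [h1 h2]; split => // j _ /=; rewrite in_itv /= h1.
  by move=> [h1 h2]; split => // j; have /= := h1 j I; rewrite in_itv /= andbT.
apply: measurableI.
  apply: fin_bigcap_measurable => // j _.
  by rewrite -[X in measurable X]setTI; apply: measurable_of_Rn.
rewrite -[X in measurable X]setTI; apply: measurable_sum => // j.
exact: measurable_of_Rn.
Qed.

Lemma volume_corner_scale n r : 0 < r ->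
  volume (@corner n r) = ((r ^+ n)%:E * volume (@corner n 1))%E.
Proof.
move=> r0.
have uM : (r^-1)%:M \in @unitmx R n.
  by rewrite unitmxE det_scalar unitfE expf_neq0// invr_eq0 gt_eqF.
rewrite -(volume_affine 0 uM (@measurable_corner n 1)) muleA -EFinM det_scalar.
rewrite normrX gtr0_norm ?invr_gt0// -exprMn divff ?gt_eqF// expr1n mul1e.
congr volume; apply/funext => x /=; rewrite addr0 mul_mx_scalar /corner /=.
have E j : (r^-1 *: x) ord0 j = r^-1 * x ord0 j by rewrite mxE.
apply/propext; split=> -[h1 h2]; split.
- by move=> j; rewrite E mulr_ge0// invr_ge0 ltW.
- by under eq_bigr do rewrite E; rewrite -mulr_sumr ler_pdivrMl// mulr1.
- by move=> j; have := h1 j; rewrite E pmulr_rge0// invr_gt0.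
- by move: h2; under eq_bigr do rewrite E; rewrite -mulr_sumr ler_pdivrMl// mulr1.
Qed.

Lemma corner_row_mx n r a (y : 'rV[R]_n) :
  @corner n.+1 r (row_mx a%:M y) <-> 0 <= a /\ corner (r - a) y.
Proof.
rewrite /corner /= big_ord_recl row_mx00.
rewrite [X in _ + X](_ : _ = \sum_j y ord0 j); last first.
  by apply: eq_bigr => j _; exact: row_mx0lift.
rewrite lerBrDl; split=> [[h1 h2]|[h0 [h1 h2]]].
  split; first by have := h1 ord0; rewrite row_mx00.
  by split=> // j; have := h1 (lift ord0 j); rewrite row_mx0lift.
split=> // j; case: (unliftP ord0 j) => [k|] ->; first by rewrite row_mx0lift.
by rewrite row_mx00.
Qed.

Lemma corner_lt0 n r : r < 0 -> @corner n r = set0.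
Proof.
move=> r0; apply/seteqP; split => // x [h1 h2].
have : 0 <= \sum_j x ord0 j by apply: sumr_ge0.
by rewrite leNgt (le_lt_trans h2).
Qed.

Lemma volume_set0 n : volume (set0 : set 'rV[R]_n) = 0.
Proof. by rewrite volumeE preimage_set0 measure0. Qed.

Lemma volume_corner_succ n r :
  volume (@corner n.+1 r) =
  (\int[@lebesgue_measure R]_(x in [set` `[0%R, r]]) volume (@corner n (r - x)%R))%E.
Proof.
rewrite volume_fst [RHS]integral_mkcond; apply: eq_integral => x _.
rewrite patchE mem_setE in_itv /=.
have -> : [set y | @corner n.+1 r (row_mx x%:M y)] =
    [set y | 0 <= x /\ @corner n (r - x) y].
  by apply/funext => y; apply/propext; exact: corner_row_mx.
case: ifPn => [/andP[x0 _]|].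
  by congr volume; apply/funext => y; apply/propext; split => [[]|].
rewrite negb_and -!ltNge => x0r.
transitivity (volume (set0 : set 'rV[R]_n)); last exact: volume_set0.
congr volume.
apply/seteqP; split => // y /= [x0]; case/orP: x0r => [|rx].
  by rewrite ltNge x0.
by rewrite corner_lt0// subr_lt0.
Qed.

Lemma volume_corner0 n : volume (@corner n.+1 0) = 0.
Proof. by rewrite volume_corner_succ set_itv1 integral_set1. Qed.

Lemma volume_corner_dim0 r : 0 <= r -> volume (@corner 0 r) = 1%:E.
Proof.
move=> r0; rewrite /volume /= (_ : _ @` _ = setT) ?diracT//.
apply/seteqP; split => // -[] _; exists 0 => //.
by split=> [[]//|]; rewrite big_ord0.
Qed.

Lemma volume_corner1 n : volume (@corner n 1) = (n`!%:R^-1)%:E.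
Proof.
elim: n => [|n IH].
  by rewrite volume_corner_dim0// fact0 invr1.
rewrite volume_corner_succ.
under eq_integral => x.
  rewrite inE /= in_itv /= => /andP[x0 x1].
  rewrite (_ : volume _ = ((1 - x) ^+ n / n`!%:R)%:E); last first.
    move: x1; rewrite le_eqVlt => /predU1P[->|x1]; last first.
      by rewrite volume_corner_scale ?subr_gt0// IH.
    (* At [x = 1] the scaling lemma does not apply: the slice is a point, of volume 1 in dimension 0
       and 0 otherwise, which agrees with [0 ^+ n]. *)
    rewrite subrr; case: (n) => [|m].
      by rewrite volume_corner_dim0// expr0 fact0 divr1.
    by rewrite volume_corner0 expr0n mul0r.
  over.
rewrite (@continuous_FTC2 _ _ (fun x => (1 - x) ^+ n.+1 * (- (n.+1)`!%:R^-1)))//=.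
- by rewrite subrr expr0n/= mul0r subr0 expr1n mul1r -EFinB sub0r opprK.
- apply: continuous_in_subspaceT => x x01; apply: cvgM; last exact: cvg_cst.
  exact: continuous_onemXn.
- exact: derivable_oo_LRcontinuous_onemXnMr.
- move=> x x01; rewrite derive1Mr//; last exact: onemXn_derivable.
  rewrite (derive_onemXn n.+1) -[unstable.onem x]/(1 - x) /= factS natrM.
  rewrite invfM mulNr mulrNN mulrAC mulrA.
  rewrite divff ?pnatr_eq0// mul1r mulrC //.
Qed.

End CornerSimplex.

(** * Symmetric coordinates for the simplex *)

Section DifferenceRows.
Variable R : realType.
Implicit Types (n : nat).

(* The coordinates on R^n = R^{n+1} / R(1,..,1) that treat all vertices of
   [S_simplex w] alike. *)
Definition diff_row n (f : 'I_n.+1 -> R) : 'rV[R]_n :=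
  \row_k (f (lift ord0 k) - f ord0).

Lemma diff_row_shift n (f : 'I_n.+1 -> R) c : diff_row (fun i => f i + c) = diff_row f.
Proof. by apply/rowP => k; rewrite !mxE opprD addrACA subrr addr0. Qed.

Lemma sum_mul_delta n (f : 'I_n -> R) i : \sum_j f j * (i == j)%:R = f i.
Proof.
rewrite (bigD1 i)//= eqxx mulr1 big1 ?addr0// => j ji.
by rewrite eq_sym (negbTE ji) mulr0.
Qed.

Lemma diff_row_sum n (f : 'I_n.+1 -> R) :
  diff_row f = \sum_j f j *: diff_row (fun i => (i == j)%:R).
Proof.
apply/rowP => k; rewrite summxE mxE.
under eq_bigr do rewrite !mxE mulrBr.
by rewrite sumrB !sum_mul_delta.
Qed.

Lemma diff_row_inj n (f g : 'I_n.+1 -> R) : diff_row f = diff_row g ->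
  forall i, f i - g i = f ord0 - g ord0.
Proof.
move=> /rowP fg i; case: (unliftP ord0 i) => [k ->|->//].
by have := fg k; rewrite !mxE => /eqP; rewrite subr_eq => /eqP ->; ring.
Qed.

Lemma diff_row_scale n (f : 'I_n.+1 -> R) c :
  diff_row (fun i => c * f i) = c *: diff_row f.
Proof. by apply/rowP => k; rewrite !mxE mulrBr. Qed.

Lemma diff_row_surj n (x : 'rV[R]_n) :
  x = diff_row (fun j => if unlift ord0 j is Some k then x ord0 k else 0).
Proof. by apply/rowP => k; rewrite mxE liftK unlift_none subr0. Qed.

(** The unit family at [ord0] has difference row [(-1,..,-1)], so vertex 0 takes the same form as
    the others. *)
Lemma S_vertexE n (w : 'I_n.+1 -> R) j :
  S_vertex w j = w j *: diff_row (fun i => (i == j)%:R).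
Proof.
rewrite /S_vertex; case: unliftP => [l|] ->.
  congr (_ *: _); apply/rowP => k; rewrite !mxE eqxx (inj_eq lift_inj).
  by rewrite (negbTE (neq_lift _ _)) subr0.
rewrite scaleNr -scalerN; congr (_ *: _); apply/rowP => k.
by rewrite !mxE eqxx eq_sym (negbTE (neq_lift _ _)) sub0r.
Qed.

(** Convex coefficients [a] and representatives [b] correspond by [b i = m * (a i * w i)]. *)
Lemma dilated_S_simplexP n (w : 'I_n.+1 -> R) (m : R) (x : 'rV[R]_n) :
  (forall i, 0 < w i) -> 0 < m ->
  [set m *: y | y in S_simplex w] x <->
  exists b : 'I_n.+1 -> R,
    [/\ forall i, 0 <= b i, \sum_i b i / w i = m & x = diff_row b].
Proof.
move=> w0 m0; split=> [[_ [a [a0 a1] ->] <-]|[b [b0 bm ->]]].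
  exists (fun i => m * (a i * w i)); split.
  - by move=> i; rewrite !mulr_ge0// ltW.
  - under eq_bigr => i _ do rewrite -mulrA mulfK ?gt_eqF//.
    by rewrite -mulr_sumr a1 mulr1.
  - rewrite diff_row_scale diff_row_sum; congr (_ *: _).
    by apply: eq_bigr => i _; rewrite S_vertexE scalerA.
exists (m^-1 *: diff_row b); last by rewrite scalerA divff ?gt_eqF// scale1r.
exists (fun i => m^-1 * (b i / w i)).
  split; first by move=> i; rewrite !mulr_ge0// ?invr_ge0 ltW.
  by rewrite -mulr_sumr bm mulVf// gt_eqF.
rewrite diff_row_sum scaler_sumr; apply: eq_bigr => i _.
by rewrite S_vertexE !scalerA -!mulrA mulVf ?mulr1// gt_eqF.
Qed.

Lemma S_simplexP n (w : 'I_n.+1 -> R) (x : 'rV[R]_n) : (forall i, 0 < w i) ->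
  S_simplex w x <->
  exists b : 'I_n.+1 -> R,
    [/\ forall i, 0 <= b i, \sum_i b i / w i = 1 & x = diff_row b].
Proof.
move=> w0; rewrite -(dilated_S_simplexP _ w0 ltr01); split=> [Sx|[y Sy <-]].
  by exists x => //; rewrite scale1r.
by rewrite scale1r.
Qed.

End DifferenceRows.

(** * The covering radius *)

Section CoveringRadius.
Variable R : realType.

(** Used twice: to average the fractional parts over all base coordinates, and to expand the square
    of the sum of the [1 / w i]. *)
Lemma sum_square_pairs n (g : 'I_n -> 'I_n -> R) :
  \sum_i \sum_j g i j =
  \sum_i g i i + \sum_(i < n) \sum_(j < n | (i < j)%N) (g i j + g j i).
Proof.
have -> : \sum_i \sum_j g i j = \sum_i g i i + \sum_(i < n) \sum_(j < n | (i < j)%N) g i j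
    + \sum_(i < n) \sum_(j < n | (j < i)%N) g i j.
  rewrite -!big_split; apply: eq_bigr => i _ /=.
  rewrite (bigD1 i)//= (bigID (fun j : 'I_n => (i < j)%N))/= addrA.
  congr (_ + _ + _); apply: eq_bigl => j.
    by rewrite -(inj_eq val_inj) neq_ltn; case: ltngtP.
  by rewrite -(inj_eq val_inj) neq_ltn; case: ltngtP.
rewrite -addrA; congr (_ + _).
rewrite [X in _ + X](exchange_big_dep predT)//= -big_split; apply: eq_bigr => i _.
by rewrite -big_split.
Qed.

(** The sum is an integer, and it is below 2 because each fractional part is below 1. *)
Lemma frac_addN_le1 (t : R) :
  (t - (Num.floor t)%:~R) + (- t - (Num.floor (- t))%:~R) <= 1.
Proof.
have -> : (t - (Num.floor t)%:~R) + (- t - (Num.floor (- t))%:~R) =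
    (- (Num.floor t + Num.floor (- t)))%:~R.
  by rewrite rmorphN rmorphD /=; ring.
suff : - (Num.floor t + Num.floor (- t)) < 1 + 1 :> int.
  by rewrite ltzD1 -(ler_int R).
rewrite -(ltr_int R) rmorphN !rmorphD /=.
have := floorD1_gt t; have := floorD1_gt (- t); rewrite !rmorphD /=; lra.
Qed.

Variables (n : nat) (w : 'I_n.+1 -> R).
Hypothesis w_gt0 : forall i, 0 < w i.
Let W := \sum_i (w i)^-1.
Let P := \sum_(i < n.+1) \sum_(j < n.+1 | (i < j)%N) (w i * w j)^-1.

Let wV_gt0 i : 0 < (w i)^-1. Proof. by rewrite invr_gt0. Qed.

Let W_gt0 : 0 < W.
Proof.
rewrite /W (bigD1 ord0)//= ltr_pwDl// sumr_ge0// => i _.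
exact: ltW.
Qed.

Lemma covering_dilations_S_simplex : (0 < n)%N ->
  covering_dilations (S_simplex w) (Zlattice R n) (P / W).
Proof.
move=> n0.
(* A pair [i < j] exists because [0 < n]; [dilated_S_simplexP] needs a positive dilation. *)
have P_gt0 : 0 < P.
  rewrite /P (bigD1 ord0)//= ltr_pwDl//; last first.
    by do 2 apply: sumr_ge0 => ? _; rewrite invr_ge0 mulr_ge0// ltW.
  rewrite (bigD1 (lift ord0 (Ordinal n0)))//= ltr_pwDl//.
    by rewrite invr_gt0 mulr_gt0.
  by apply: sumr_ge0 => ? _; rewrite invr_ge0 mulr_ge0// ltW.
have mu0 : 0 < P / W by rewrite divr_gt0.
split; first exact: ltW.
apply/seteqP; split => // x _; rewrite (diff_row_surj x).
set y := (X in diff_row X).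
pose fr i j : R := y j - y i - (Num.floor (y j - y i))%:~R.
have fr0 i j : 0 <= fr i j by rewrite subr_ge0 floor_le.
pose m i := \sum_j fr i j / w j.
have [i mi] : exists i, m i <= P / W.
  apply: contrapT => /forallNP h.
  (* If every [m i] exceeded [P / W], so would their weighted mean, whereas the terms [(i, j)] and
     [(j, i)] together contribute at most [1 / (w i * w j)] and the diagonal vanishes. *)
  suff : P / W * W < P by rewrite divfK ?gt_eqF// ltxx.
  apply: (@lt_le_trans _ _ (\sum_i m i / w i)).
    rewrite {2}/W mulr_sumr; apply: ltr_sum => [|i _].
      by apply/hasP; exists ord0; rewrite ?mem_index_enum.
    by rewrite ltr_pM2r// ltNge; apply/negP.
  rewrite /m; under eq_bigr do rewrite mulr_suml.
  rewrite sum_square_pairs big1 ?add0r; last first.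
    by move=> i _; rewrite /fr subrr floor0 subr0 !mul0r.
  apply: ler_sum => i _; apply: ler_sum => j _.
  rewrite invfM -2!mulrA [(w j)^-1 * _]mulrC -mulrDl.
  apply: ler_piMl; first by rewrite mulr_ge0// ltW.
  by have := frac_addN_le1 (y j - y i); rewrite opprB.
(* Adding a constant to a representative leaves the point unchanged; this one raises the weighted
   sum from [m i] to exactly [P / W]. *)
pose c := (P / W - m i) / W.
have c0 : 0 <= c by rewrite divr_ge0 ?subr_ge0// ltW.
have [s Ss sE] : [set (P / W) *: s | s in S_simplex w] (diff_row (fun j => fr i j + c)).
  apply/dilated_S_simplexP => //; exists (fun j => fr i j + c); split => //.
    by move=> j; rewrite addr_ge0.
  under eq_bigr do rewrite mulrDl.
  rewrite big_split /= -mulr_sumr -/W -/(m i) /c divfK ?gt_eqF//.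
  by rewrite addrC subrK.
exists s => //; exists (diff_row (fun j => (Num.floor (y j - y i))%:~R)).
  by move=> k; rewrite mxE rpredB// intr_int.
by rewrite sE; apply/rowP => k; rewrite !mxE /fr; ring.
Qed.

Let y (i : 'I_n.+1) : R := (\sum_(j < n.+1 | (j < i)%N) (w j)^-1) / W.

Let head_tail (i : 'I_n.+1) :
  \sum_(j < n.+1 | (j < i)%N) (w j)^-1 + \sum_(j < n.+1 | (i <= j)%N) (w j)^-1 = W.
Proof.
rewrite /W [RHS](bigID (fun j : 'I_n.+1 => (j < i)%N))/=; congr (_ + _).
by apply: eq_bigl => j; rewrite -leqNgt.
Qed.

Let y_lt1 i : y i < 1.
Proof.
rewrite /y ltr_pdivrMr// mul1r -(head_tail i) ltrDl (bigD1 i)//= ltr_pwDl//.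
by apply: sumr_ge0 => j _; apply: ltW.
Qed.

(** Let [k] be the first index with [1 <= y k + t]. The carries contribute at most the total weight
    from [k] on, which is [(1 - y k) * W], hence at most [t * W]. *)
Let sum_carry (t : R) : 0 <= t ->
  \sum_(i < n.+1) (1 <= y i + t)%R%:R / w i <= t * W.
Proof.
move=> t0.
have [i0 yi0|no] := pickP (fun i => 1 <= y i + t); last first.
  rewrite big1; first by rewrite mulr_ge0// ltW.
  by move=> i _; rewrite no mul0r.
have [k yk kmin] := @arg_minnP _ i0 (fun i => 1 <= y i + t) (@nat_of_ord n.+1) yi0.
apply: (@le_trans _ _ (\sum_(j < n.+1 | (k <= j)%N) (w j)^-1)).
  rewrite [leRHS]big_mkcond; apply: ler_sum => i _ /=.
  have [/kmin ->|_] := boolP (1 <= y i + t); first by rewrite mul1r.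
  by rewrite mul0r; case: ifP => // _; exact: ltW.
have : (1 - y k) * W <= t * W by rewrite ler_pM2r// lerBlDl.
apply: le_trans; rewrite mulrBl mul1r /y divfK ?gt_eqF// -(head_tail k).
by rewrite addrAC subrr add0r.
Qed.

Let sum_y : \sum_i y i / w i = P / W.
Proof.
rewrite /y; under eq_bigr do rewrite mulrAC mulr_suml.
rewrite -mulr_suml; congr (_ / _).
rewrite (exchange_big_dep predT)//=; apply: eq_bigr => i _.
by apply: eq_bigr => j _; rewrite invfM.
Qed.

(* The last point covered by the growing translates is [diff_row y], whose
   coordinates are the partial sums of the weights [1 / w j], normalized. *)
Lemma lbound_covering_dilations_S_simplex :
  lbound (covering_dilations (S_simplex w) (Zlattice R n)) (P / W).
Proof.
move=> m [m0 cover].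
have : [set m *: x + z | x in S_simplex w & z in Zlattice R n] (diff_row y).
  by rewrite cover.
case=> s /(S_simplexP _ w_gt0)[b' [b'0 b'1 ->]] [z Zz].
pose zf i : R := if unlift ord0 i is Some k then z ord0 k else 0.
pose b i := m * b' i.
have b0 i : 0 <= b i by rewrite mulr_ge0.
have bm : \sum_i b i / w i = m.
  by rewrite /b; under eq_bigr do rewrite -mulrA; rewrite -mulr_sumr b'1 mulr1.
rewrite -diff_row_scale -/b (diff_row_surj z) -/zf.
have -> : diff_row b + diff_row zf = diff_row (fun i => b i + zf i).
  by apply/rowP => k; rewrite !mxE; ring.
have y0 : y ord0 = 0 by rewrite /y big_pred0 ?mul0r.
move=> /diff_row_inj bz.
have {}bz i : b i = y i + b ord0 - zf i.
  have := bz i; rewrite y0 /zf unlift_none; lra.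
pose t := b ord0 - (Num.floor (b ord0))%:~R.
have t0 : 0 <= t by rewrite subr_ge0 floor_le.
have t1 : t < 1 by have := floorD1_gt (b ord0); rewrite /t rmorphD /=; lra.
(* [b i] is nonnegative and differs from [y i + t] by an integer. As [y i + t < 2], that integer is
   at most 1, and at most 0 when there is no carry. *)
have bi i : y i + t - (1 <= y i + t)%R%:R <= b i.
  have [c cE] : exists c : int, c%:~R = zf i - (Num.floor (b ord0))%:~R.
    have : zf i - (Num.floor (b ord0))%:~R \is a Num.int.
      rewrite rpredB ?intr_int// /zf; case: unlift => [k|]; last exact: rpred0.
      exact: Zz.
    by move=> /intrP[c ->]; exists c.
  have bE : b i = y i + t - c%:~R by rewrite cE /t bz; ring.
  rewrite bE lerD2l lerN2; have := b0 i; rewrite bE subr_ge0 => ct.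
  have [_|yt1] := leP 1 (y i + t).
    rewrite -[1%:R]/((1 : int)%:~R) ler_int -ltzD1 -(ltr_int R).
    by rewrite (le_lt_trans ct)// rmorphD /= ltrD.
  by rewrite -[0%:R]/((0 : int)%:~R) ler_int -ltzD1 -(ltr_int R) (le_lt_trans ct).
rewrite -sum_y -bm.
(* The shift by [t] adds [t * W], and by [sum_carry] the carries take away no more than that. *)
apply: (@le_trans _ _ (\sum_i (y i + t - (1 <= y i + t)%R%:R) / w i)).
  under [leRHS]eq_bigr do rewrite mulrBl mulrDl.
  rewrite sumrB big_split /= -mulr_sumr -/W -addrA lerDl subr_ge0.
  exact: sum_carry.
by apply: ler_sum => i _; rewrite ler_pM2r.
Qed.

End CoveringRadius.

(** * Volumes and determinants of the projections *)

Section SimplexVolume.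
Variable R : realType.

(** The matrix determinant lemma: the bordered matrix with blocks [1], [- v], [u], [diag_mx d] is
    factored by eliminating either diagonal block, and the determinants are compared. *)
Lemma det_diag_rank1 n (d v : 'rV[R]_n) (u : 'cV[R]_n) :
  (forall k, d ord0 k != 0) ->
  \det (diag_mx d + u *m v) =
  (\prod_k d ord0 k) * (1 + \sum_k v ord0 k * u k ord0 / d ord0 k).
Proof.
move=> d0; pose E := diag_mx (\row_k (d ord0 k)^-1).
have ED : E *m diag_mx d = 1%:M.
  rewrite mulmx_diag; apply/matrixP => i j; rewrite !mxE mulVf//.
have eq1 : block_mx 1%:M (- v) u (diag_mx d) =
    block_mx 1%:M 0 u 1%:M *m block_mx 1%:M (- v) 0 (diag_mx d + u *m v).
  rewrite mulmx_block !mul1mx !mul0mx !mulmx1 !addr0 mulmxN.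
  by rewrite [- _ + _]addrC addrK.
have eq2 : block_mx 1%:M (- v) u (diag_mx d) =
    block_mx 1%:M (- (v *m E)) 0 1%:M *m
    block_mx (1%:M + v *m E *m u) 0 u (diag_mx d).
  rewrite mulmx_block !mul1mx !mul0mx !mulNmx addrK !add0r.
  by rewrite -mulmxA ED mulmx1.
have := congr1 determinant eq1; rewrite eq2 !det_mulmx !det_ublock !det_lblock.
rewrite !det1 !mul1r det_diag det_mx11 => <-; rewrite mulrC; congr (_ * _).
rewrite !mxE eqxx; congr (_ + _); apply: eq_bigr => k _.
by rewrite mul_mx_diag !mxE mulrAC.
Qed.

(** The coefficient of [v ord0] is determined by the others, which form a point of the corner
    simplex. *)
Lemma conv_hull_cornerP n k (v : 'I_k.+1 -> 'rV[R]_n) z :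
  conv_hull v z <-> exists2 y : 'rV[R]_k, corner 1 y
    & z = y *m (\matrix_(j < k) (v (lift ord0 j) - v ord0)) + v ord0.
Proof.
have yM (y : 'rV[R]_k) : y *m (\matrix_(j < k) (v (lift ord0 j) - v ord0)) =
    \sum_j y ord0 j *: v (lift ord0 j) - (\sum_j y ord0 j) *: v ord0.
  rewrite mulmx_sum_row scaler_suml -sumrB; apply: eq_bigr => j _.
  by rewrite rowK scalerBr.
split=> [[a [a0 a1] ->]|[y [y0 y1] ->]].
  move: a1; rewrite !big_ord_recl => a1.
  exists (\row_j a (lift ord0 j)).
    split=> [j|]; first by rewrite mxE.
    by under eq_bigr do rewrite mxE; rewrite -a1 lerDr.
  rewrite yM; under [X in _ = X - _ + _]eq_bigr do rewrite mxE.
  under [X in _ - X *: _]eq_bigr do rewrite mxE.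
  rewrite [LHS]addrC -addrA; congr (_ + _).
  by rewrite -{1}[a ord0](addrK (\sum_i a (lift ord0 i))) a1 scalerBl scale1r addrC.
exists (fun i => if unlift ord0 i is Some j then y ord0 j else 1 - \sum_j y ord0 j).
  split=> [i|]; first by case: unliftP => [j|] _ //; rewrite subr_ge0.
  rewrite big_ord_recl unlift_none; under [X in _ + X]eq_bigr do rewrite liftK.
  by rewrite subrK.
rewrite yM big_ord_recl unlift_none; under [X in _ = _ + X]eq_bigr do rewrite liftK.
by rewrite scalerBl scale1r [LHS]addrAC [RHS]addrAC [X in X - _]addrC.
Qed.

Lemma volume_conv_hull n (v : 'I_n.+1 -> 'rV[R]_n)
    (M := \matrix_(j < n) (v (lift ord0 j) - v ord0)) : M \in unitmx ->
  measurable_rV (conv_hull v) /\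
  volume (conv_hull v) = (`|\det M| / n`!%:R)%:E.
Proof.
move=> uM.
have E1 : conv_hull v = [set x | corner 1 (x *m invmx M - v ord0 *m invmx M)].
  apply/funext => x /=; apply/propext; rewrite conv_hull_cornerP -/M.
  split=> [[y y1 ->]|h]; first by rewrite mulmxDl mulmxK// addrK.
  by eexists; first exact: h; rewrite mulmxBl !mulmxKV// subrK.
have mS : measurable_rV (conv_hull v).
  by rewrite E1; apply: measurable_rV_affine; exact: measurable_corner.
split=> //; rewrite -(volume_affine (v ord0) uM mS) EFinM -volume_corner1.
congr (_ * volume _)%E; apply/funext => y /=; rewrite E1 /=.
by rewrite mulmxDl mulmxK// addrK.
Qed.

(** The edges from vertex 0 form a diagonal matrix plus [w ord0] times the all-ones matrix, which
    has rank one. *)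
Lemma measurable_volume_S_simplex n (w : 'I_n.+1 -> R) : (forall i, 0 < w i) ->
  measurable_rV (S_simplex w) /\
  volume (S_simplex w) =
    (((\prod_i w i) * \sum_i (w i)^-1) / n`!%:R)%:E.
Proof.
move=> w0.
pose M := \matrix_(j < n) (S_vertex w (lift ord0 j) - S_vertex w ord0).
have ME : M = diag_mx (\row_k w (lift ord0 k)) +
      (const_mx (w ord0) : 'cV[R]_n) *m (const_mx 1 : 'rV[R]_n).
  apply/matrixP => j k; rewrite !mxE big_ord1 !mxE /S_vertex liftK unlift_none.
  by rewrite !mxE eqxx mulNr opprK (eq_sym k) mulr_natr.
have detM : \det M = (\prod_i w i) * \sum_i (w i)^-1.
  rewrite ME det_diag_rank1 => [|k]; last by rewrite mxE gt_eqF.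
  rewrite !big_ord_recl (mulrC (w ord0)) -mulrA [w ord0 * (_ + _)]mulrDr mulfV ?gt_eqF//.
  congr (_ * (_ + _)); first by apply: eq_bigr => k _; rewrite mxE.
  rewrite mulr_sumr.
  by apply: eq_bigr => k _; rewrite !mxE mul1r.
have detM0 : 0 < \det M.
  rewrite detM mulr_gt0//; first by apply: prodr_gt0.
  rewrite (bigD1 ord0)//= ltr_pwDl ?invr_gt0// sumr_ge0// => i _.
  by rewrite invr_ge0 ltW.
have uM : M \in unitmx by rewrite unitmxE unitfE gt_eqF.
have [mS volS] := volume_conv_hull uM; split=> //.
by rewrite volS gtr0_norm// detM.
Qed.

Lemma volume_image_linear n (B : 'M[R]_n) (A : set 'rV[R]_n) :
  B \in unitmx -> measurable_rV A ->
  volume [set x *m B | x in A] = (`|\det B|%:E * volume A)%E.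
Proof.
move=> uB mA.
have -> : [set x *m B | x in A] = [set x | A (x *m invmx B + 0)].
  apply/seteqP; split=> [_ [x Ax <-]|x /= Ax]; first by rewrite /= addr0 mulmxK.
  by exists (x *m invmx B + 0) => //; rewrite addr0 mulmxKV.
have mA' := measurable_rV_affine (invmx B) 0 mA.
have uB' : invmx B \in unitmx by rewrite unitmx_inv.
rewrite -(volume_affine 0 uB' mA) muleA -EFinM -normrM -det_mulmx mulmxV// det1.
by rewrite normr1 mul1e.
Qed.

Lemma int_det n (U : 'M[R]_n) : (forall i j, U i j \is a Num.int) ->
  \det U \is a Num.int.
Proof.
move=> intU; rewrite /determinant rpred_sum// => s _.
by rewrite rpredM ?rpredX ?rpredN ?rpred1// rpred_prod.
Qed.

(** The transition matrix is integral and invertible, so its determinant is a nonzero integer. *)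
Lemma det_sublattice n (B B' : 'M[R]_n) : B \in unitmx -> B' \in unitmx ->
  [set z *m B | z in Zlattice R n] `<=` [set z *m B' | z in Zlattice R n] ->
  `|\det B'| <= `|\det B|.
Proof.
move=> uB uB' BB'; pose U := B *m invmx B'.
have intU i j : U i j \is a Num.int.
  have [|z Zz zE] := BB' (row i B).
    exists (delta_mx ord0 i); last by rewrite -rowE.
    by move=> k; rewrite mxE eqxx; case: (_ == _).
  have -> : U i j = z ord0 j.
    have : row i U = z by rewrite /U row_mul -zE mulmxK.
    by move=> /rowP/(_ j); rewrite mxE.
  exact: Zz.
have -> : B = U *m B' by rewrite /U mulmxKV.
rewrite det_mulmx normrM ler_peMl// norm_intr_ge1 ?int_det//.
by rewrite -unitfE -unitmxE unitmx_mul uB unitmx_inv.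
Qed.

(** [det_sublattice] in both directions shows that [xget] chooses from a singleton. *)
Lemma lattice_det_basis n (B : 'M[R]_n) : B \in unitmx ->
  lattice_det [set z *m B | z in Zlattice R n] = `|\det B|.
Proof.
move=> uB; apply: xget_subset1; first by exists B.
move=> _ _ [B1 [u1 E1] <-] [B2 [u2 E2] <-]; apply/eqP; rewrite eq_le.
by rewrite !det_sublattice// -E1 -E2.
Qed.

End SimplexVolume.

(** * Projection along one vertex *)

Section VertexProjection.
Variables (R : realType) (n : nat) (w : 'I_n.+2 -> R).
Hypothesis w_gt0 : forall j, 0 < w j.
Variables (i : 'I_n.+2) (p : {linear 'rV[R]_n.+1 -> 'rV[R]_n}).
Hypothesis ker_p : forall x, p x = 0 <-> exists a : R, x = a *: S_vertex w i.

(** In the symmetric coordinates [p] kills the [i]-th unit class, and the images of the remaining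
    [n.+1] classes sum to zero. The rows are these images, the first one omitted. *)
Definition projection_mx : 'M[R]_n :=
  \matrix_(k < n) p (diff_row (fun j => (j == lift i (lift ord0 k))%:R)).
Local Notation B := projection_mx.

Lemma projection_diff_row (f : 'I_n.+2 -> R) :
  p (diff_row f) = diff_row (f \o lift i) *m B.
Proof.
(* Subtracting this constant removes the term of the one class that has no row in [B]. *)
pose c := f (lift i ord0).
have pi0 : p (diff_row (fun j => (j == i)%:R)) = 0.
  by apply/ker_p; exists (w i)^-1; rewrite S_vertexE scalerA mulVf ?scale1r// gt_eqF.
rewrite -(diff_row_shift f (- c)) diff_row_sum linear_sum (bigD1_ord i)//=.
rewrite linearZ /= pi0 scaler0 add0r big_ord_recl subrr scale0r linear0 add0r.
rewrite mulmx_sum_row; apply: eq_bigr => k _.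
by rewrite linearZ rowK mxE.
Qed.

(** A row [y] killed by [B] lifts to a family [f] whose difference row lies in the kernel of [p].
    Such an [f] is constant away from [i], and it is zero at [lift i ord0], so [y = 0]. *)
Lemma projection_mx_unit : B \in unitmx.
Proof.
rewrite -row_free_unit -kermx_eq0; apply/rowV0P => y /sub_kermxP yB.
pose f j := if unlift i j is Some l then
  (if unlift ord0 l is Some k then y ord0 k else 0) else 0.
have fE l : f (lift i l) = if unlift ord0 l is Some k then y ord0 k else 0.
  by rewrite /f liftK.
have yE : y = diff_row (f \o lift i).
  rewrite [LHS]diff_row_surj; congr diff_row; apply/funext => l.
  by rewrite /= fE.
have [a] : exists a, diff_row f = a *: S_vertex w i.
  by apply/ker_p; rewrite projection_diff_row -yE.
rewrite S_vertexE scalerA -diff_row_scale => /diff_row_inj fa.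
apply/rowP => k; rewrite [RHS]mxE.
have := fa (lift i (lift ord0 k)); rewrite -(fa (lift i ord0)) !fE liftK unlift_none.
by rewrite ![_ == i]eq_sym !(negbTE (neq_lift _ _)) !mulr0 !subr0.
Qed.

Lemma projection_S_simplex :
  p @` S_simplex w = [set x *m B | x in S_simplex (w \o lift i)].
Proof.
have w'_gt0 j : 0 < (w \o lift i) j by exact: w_gt0.
have sumD (b : 'I_n.+2 -> R) : \sum_j b j / w j =
    b i / w i + \sum_j b (lift i j) / w (lift i j) by rewrite (bigD1_ord i).
apply/seteqP; split=> [_ [_ /(S_simplexP _ w_gt0)[b [b0 b1 ->]] <-]|].
  pose W' := \sum_j (w (lift i j))^-1.
  have W'0 : 0 < W'.
    rewrite /W' big_ord_recl ltr_pwDl ?invr_gt0// sumr_ge0// => j _.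
    by rewrite invr_ge0 ltW.
  (* The weight of the dropped coordinate is spread as a constant over the others, which [diff_row]
     does not see. *)
  pose c := b i / w i / W'.
  have c0 : 0 <= c by rewrite !divr_ge0// ltW.
  exists (diff_row (fun j => (b \o lift i) j + c)); last first.
    by rewrite diff_row_shift projection_diff_row.
  apply/S_simplexP => //; exists (fun j => (b \o lift i) j + c); split=> //.
    by move=> j; rewrite addr_ge0// b0.
  under eq_bigr do rewrite mulrDl.
  rewrite big_split /= -mulr_sumr -/W' /c divfK ?gt_eqF//.
  by rewrite addrC -sumD.
move=> _ [_ /(S_simplexP _ w'_gt0)[b [b0 b1 ->]] <-].
pose b' j := if unlift i j is Some l then b l else 0.
have b'E l : b' (lift i l) = b l by rewrite /b' liftK.
exists (diff_row b'); last first.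
  rewrite projection_diff_row; congr (diff_row _ *m _).
  by apply/funext => l; rewrite /= b'E.
apply/S_simplexP => //; exists b'; split=> //.
  by move=> j; rewrite /b'; case: unlift.
rewrite sumD /b' unlift_none mul0r add0r -b1; apply: eq_bigr => l _.
by rewrite liftK.
Qed.

Lemma projection_Zlattice :
  p @` Zlattice R n.+1 = [set z *m B | z in Zlattice R n].
Proof.
apply/seteqP; split=> [_ [z Zz <-]|_ [y Zy <-]].
  rewrite (diff_row_surj z) projection_diff_row; eexists; last by [].
  by move=> k; rewrite mxE rpredB//=; case: unlift => [l|]; rewrite ?rpred0.
pose f j := if unlift i j is Some l then
  (if unlift ord0 l is Some k then y ord0 k else 0) else 0.
have intf j : f j \is a Num.int.
  rewrite /f; case: unlift => [l|]; last exact: rpred0.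
  by case: unlift => [k|]; [exact: Zy|exact: rpred0].
exists (diff_row f); first by move=> k; rewrite mxE rpredB.
rewrite projection_diff_row [y in RHS]diff_row_surj; congr (diff_row _ *m _).
by apply/funext => l; rewrite /= /f liftK.
Qed.

Lemma normalized_volume_projection :
  normalized_volume (p @` Zlattice R n.+1) (p @` S_simplex w) =
  (\prod_(j < n.+1) w (lift i j)) * \sum_(j < n.+1) (w (lift i j))^-1.
Proof.
have w'_gt0 j : 0 < (w \o lift i) j by exact: w_gt0.
have [mS volS] := measurable_volume_S_simplex w'_gt0.
have detB : `|\det B| != 0.
  by rewrite normr_eq0 -unitfE -unitmxE projection_mx_unit.
rewrite /normalized_volume projection_Zlattice projection_S_simplex.
rewrite (lattice_det_basis projection_mx_unit).
rewrite (volume_image_linear projection_mx_unit mS) volS -EFinM /=.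
by field; rewrite detB pnatr_eq0 -lt0n fact_gt0.
Qed.

End VertexProjection.

(** * Normalized volume of the simplex, and the conclusion *)

Lemma normalized_volume_S_simplex (R : realType) (n : nat) (w : 'I_n.+1 -> R) :
  (forall j, 0 < w j) ->
  normalized_volume (Zlattice R n) (S_simplex w) =
  (\prod_j w j) * \sum_j (w j)^-1.
Proof.
move=> w_gt0; have [mS volS] := measurable_volume_S_simplex w_gt0.
have -> : Zlattice R n = [set z *m 1%:M | z in Zlattice R n].
  apply/seteqP; split=> [z Zz|_ [z Zz <-]]; last by rewrite mulmx1.
  by exists z; rewrite ?mulmx1.
rewrite /normalized_volume (lattice_det_basis (unitmx1 _ _)) det1 normr1 divr1.
by rewrite volS /= mulrC divfK// pnatr_eq0 -lt0n fact_gt0.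
Qed.

Theorem theorem1p4 (R : realType) (d : nat) (d_gt0 : (0 < d)%N)
  (w : 'I_d.+1 -> R) (w_gt0 : forall i, 0 < w i)
  (p : 'I_d.+1 -> {linear 'rV[R]_d -> 'rV[R]_d.-1})
  (ker_p : forall i x, p i x = 0 <-> exists a : R, x = a *: S_vertex w i) :
  let mu := (\sum_(i < d.+1) \sum_(j < d.+1 | (i < j)%N) (w i * w j)^-1)
            / (\sum_(i < d.+1) (w i)^-1) in
  is_covering_radius (S_simplex w) (Zlattice R d) mu /\
  mu = 2^-1 * ((\sum_(i < d.+1)
                  normalized_volume (p i @` Zlattice R d) (p i @` S_simplex w))
               / normalized_volume (Zlattice R d) (S_simplex w)).
Proof.
move=> mu; split.
  by split; [exact: covering_dilations_S_simplex|
             exact: lbound_covering_dilations_S_simplex].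
case: d d_gt0 w w_gt0 p ker_p @mu => // n _ w w_gt0 p ker_p mu.
(* Dropping [w i] divides the product by [w i] and subtracts [1 / w i] from the sum of inverses. *)
have nv i : normalized_volume (p i @` Zlattice R n.+1) (p i @` S_simplex w) =
    (\prod_j w j) * ((w i)^-1 * \sum_j (w j)^-1 - (w i * w i)^-1).
  have -> : normalized_volume (p i @` Zlattice R n.+1) (p i @` S_simplex w) =
      (\prod_(j < n.+1) w (lift i j)) * \sum_(j < n.+1) (w (lift i j))^-1.
    exact: (normalized_volume_projection w_gt0 (ker_p i)).
  rewrite !(bigD1_ord i)//=.
  by field; rewrite gt_eqF.
under eq_bigr do rewrite nv.
rewrite normalized_volume_S_simplex// -mulr_sumr sumrB.
(* In the square of the sum of inverses the diagonal cancels against the subtracted squares, leaving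
   twice the pair sum; hence the factor one half. *)
have -> : \sum_(i < n.+2) (w i)^-1 * \sum_j (w j)^-1 =
    \sum_(i < n.+2) (w i * w i)^-1 +
    2 * \sum_(i < n.+2) \sum_(j < n.+2 | (i < j)%N) (w i * w j)^-1.
  under eq_bigr do rewrite mulr_sumr.
  rewrite sum_square_pairs; congr (_ + _).
    by apply: eq_bigr => i _; rewrite invfM.
  rewrite mulr_sumr; apply: eq_bigr => i _; rewrite mulr_sumr.
  by apply: eq_bigr => j _; rewrite invfM [(w j)^-1 * _]mulrC mulr2n mulrDl mul1r.
have W0 : \sum_(i < n.+2) (w i)^-1 != 0.
  rewrite gt_eqF// big_ord_recl ltr_pwDl ?invr_gt0// sumr_ge0// => j _.
  by rewrite invr_ge0 ltW.
have prod0 : \prod_(i < n.+2) w i != 0 by rewrite gt_eqF// prodr_gt0.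
by rewrite /mu addrC addKr; field; rewrite W0 prod0.
Qed.
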